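(* Let $M$ be a positive integer. For $n\ge2$ let $H_{M,n}$ be the graph whose vertices are: junction nodes $c_1,\dots,c_n$; nodes $a_{i,s}$ for $1\le i\le n$, $1\le s\le M n$; and nodes $b_{i,j,k}$ for $1\le i\le n-1$, $1\le j\le 2M$, $k\in\{1,2\}$. Its edges are: for each $1\le i\le n-1$ and each $k\in\{1,2\}$, the edges of the path $c_i - b_{i,1,k} - b_{i,2,k} - \cdots - b_{i,2M,k} - c_{i+1}$; and an edge between $c_i$ and $a_{i,s}$ for all $i,s$. Then, with $M$ fixed and $n\to\infty$, and with vertices sampled uniformly at random: (1) $\mathbb{E}\zeta_{slim}(H_{M,n})\to M$; (2) $\mathbb{E}\eta_{minsize}(H_{M,n})\to 0$.
   Context: Let $G$ be a finite connected graph with shortest-path metric $d$. A geodesic triangle $\Delta(x,y,z)$ is a choice of shortest paths $[x,y],[y,z],[z,x]$ (regarded as vertex sets). $\mathrm{slim}(\Delta(x,y,z))$ is the smallest $\delta\ge0$ such that every vertex on one side is at distance at most $\delta$ from the union of the other two sides (for each of the three sides). $\mathrm{minsize}(\Delta(x,y,z))=\min\mathrm{diam}\{x',y',z'\}$ over vertices $x'\in[y,z]$, $y'\in[z,x]$, $z'\in[x,y]$. A random triangle on $x,y,z$ is obtained by choosing each side independently and uniformly among all shortest paths between its endpoints. $\mathbb{E}\zeta_{slim}(G)$ (resp. $\mathbb{E}\eta_{minsize}(G)$) is the expectation of $\mathrm{slim}(\Delta(x,y,z))$ (resp. $\mathrm{minsize}(\Delta(x,y,z))$) over $x,y,z$ i.i.d.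 uniform vertices of $G$ and the random triangle. *)

(* Defs.v *)
From mathcomp Require Import all_boot all_order all_algebra.
From mathcomp Require Import reals.

Set Implicit Arguments.
Unset Strict Implicit.
Unset Printing Implicit Defensive.

Import GRing.Theory.

Record cgraph := CGraph {
  vertex :> finType;
  edge : rel vertex;
  edge_sym : symmetric edge;
  edge_irr : irreflexive edge;
  edge_connected : forall x y, connect edge x y
}.

Section Triangles.
Variable G : cgraph.

Definition walk (x y : G) (m : nat) : bool :=
  [exists p : m.-tuple G, path (@edge G) x p && (last x p == y)].

Lemma walk_exists (x y : G) : exists m, walk x y m.
Proof.
have /connectP [p e_p ->] := edge_connected x y.
by exists (size p); apply/existsP; exists (in_tuple p); rewrite e_p eqxx.
Qed.

Definition dist (x y : G) : nat := ex_minn (walk_exists x y).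

(* A shortest path from x to y, given by its successive vertices after x. *)
Definition geodesic (x y : G) : finType :=
  {p : (dist x y).-tuple G | path (@edge G) x p && (last x p == y)}.

Definition side (x y : G) (p : geodesic x y) : {set G} :=
  [set v in x :: val p].

Lemma side_left (x y : G) (p : geodesic x y) : x \in side p.
Proof. by rewrite inE mem_head. Qed.

Definition diam (A : {set G}) : nat :=
  \max_(u in A) \max_(v in A) dist u v.

(* A lies in the delta-neighbourhood of B. *)
Definition covered (A B : {set G}) (delta : nat) : bool :=
  [forall u in A, [exists v in B, dist u v <= delta]].

Lemma covered_diam (A B : {set G}) v : v \in B -> covered A B (diam setT).
Proof.
move=> Bv; apply/'forall_implyP => u _; apply/existsP; exists v.
rewrite Bv /= /diam (bigD1 u) ?inE //= leq_max.
by rewrite (bigD1 v) ?inE //= leq_maxl.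
Qed.

Section Triangle.
Variables (x y z : G) (p : geodesic x y) (q : geodesic y z) (r : geodesic z x).

Definition slim_with (delta : nat) : bool :=
  [&& covered (side p) (side q :|: side r) delta,
      covered (side q) (side r :|: side p) delta
    & covered (side r) (side p :|: side q) delta].

Lemma slim_with_exists : exists delta, slim_with delta.
Proof.
exists (diam setT); apply/and3P; split.
- by apply: (@covered_diam _ _ y); rewrite inE side_left.
- by apply: (@covered_diam _ _ z); rewrite inE side_left.
- by apply: (@covered_diam _ _ x); rewrite inE side_left.
Qed.

(* Distances are integers, so the least admissible real number is the least
   admissible natural number. *)
Definition slim : nat := ex_minn slim_with_exists.

Definition has_size (m : nat) : bool :=
  [exists x' in side q, [exists y' in side r, [exists z' in side p,
    diam [set x'; y'; z'] == m]]].

Lemma has_size_exists : exists m, has_size m.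
Proof.
exists (diam [set y; z; x]).
apply/existsP; exists y; rewrite side_left /=.
apply/existsP; exists z; rewrite side_left /=.
by apply/existsP; exists x; rewrite side_left /=.
Qed.

Definition minsize : nat := ex_minn has_size_exists.

End Triangle.
End Triangles.

Local Open Scope ring_scope.

(* Expectation of F at a uniformly distributed element of T. *)
Definition avg (R : realType) (T : finType) (F : T -> R) : R :=
  (\sum_(t : T) F t) / #|T|%:R.

(* Nested averages express the independence of the three vertices and,
   given the vertices, of the three sides. *)
Definition E_triangle (R : realType) (G : cgraph)
    (f : forall x y z : G,
       geodesic x y -> geodesic y z -> geodesic z x -> nat) : R :=
  avg (fun x : G => avg (fun y : G => avg (fun z : G =>
    avg (fun p : geodesic x y => avg (fun q : geodesic y z =>
      avg (fun r : geodesic z x => (f x y z p q r)%:R : R)))))).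

Definition E_slim (R : realType) (G : cgraph) : R :=
  E_triangle R (@slim G).

Definition E_minsize (R : realType) (G : cgraph) : R :=
  E_triangle R (@minsize G).

Local Close Scope ring_scope.

Section GraphH.
Variables M n : nat.

(* All indices start at 0: c_i, a_{i,s}, b_{i,j,k} are represented by
   cnode (i-1), anode (i-1) (s-1), bnode (i-1) (j-1) (k-1). *)
Definition H_vertex : finType :=
  ('I_n + 'I_n * 'I_(M * n) + 'I_n.-1 * 'I_(2 * M) * 'I_2)%type.

Definition cnode (i : 'I_n) : H_vertex := inl (inl i).
Definition anode (i : 'I_n) (s : 'I_(M * n)) : H_vertex := inl (inr (i, s)).
Definition bnode (i : 'I_n.-1) (j : 'I_(2 * M)) (k : 'I_2) : H_vertex :=
  inr (i, j, k).

(* Each edge, in one orientation. *)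
Definition H_arc (u v : H_vertex) : bool :=
  match u, v with
  | inl (inl i), inl (inr (i', _)) => i == i'
  | inl (inl i), inr (i', j, _) => (i == i' :> nat) && (j == 0 :> nat)
  | inr (i', j, _), inl (inl i) => (j.+1 == 2 * M) && (i == i'.+1 :> nat)
  | inr (i, j, k), inr (i', j', k') =>
      [&& i == i', k == k' & j' == j.+1 :> nat]
  | _, _ => false
  end.

Definition H_edge : rel H_vertex := fun u v => H_arc u v || H_arc v u.

Lemma H_edge_sym : symmetric H_edge.
Proof. by move=> u v; rewrite /H_edge orbC. Qed.

Lemma H_edge_irr : irreflexive H_edge.
Proof.
move=> [[i|[i s]]|[[i j] k]] //; rewrite /H_edge /= orbb !eqxx /=.
exact/ltn_eqF.
Qed.

Hypothesis M_gt0 : 0 < M.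

Lemma H_edge_connected (u v : H_vertex) : connect H_edge u v.
Proof.
have csym := sym_connect_sym H_edge_sym.
have cb (i : 'I_n) (i' : 'I_n.-1) m (hm : m < 2 * M) k : i = i' :> nat ->
    connect H_edge (cnode i) (bnode i' (Ordinal hm) k).
  move=> ii'; elim: m hm => [|m IH] hm.
    by apply: connect1; rewrite /H_edge /= ii' eqxx.
  apply: connect_trans (IH (ltnW hm)) (connect1 _).
  by rewrite /H_edge /= !eqxx.
have cc m (h0 : 0 < n) (hm : m < n) :
    connect H_edge (cnode (Ordinal h0)) (cnode (Ordinal hm)).
  elim: m hm => [|m IH] hm; first by rewrite (bool_irrelevance h0 hm).
  apply: connect_trans (IH (ltnW hm)) _.
  have hm' : m < n.-1 by rewrite -ltnS prednK.
  have hl : (2 * M).-1 < 2 * M by rewrite prednK ?muln_gt0.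
  apply: connect_trans (connect1 _).
    exact: (cb (Ordinal (ltnW hm)) (Ordinal hm') _ hl ord0 (erefl _)).
  by rewrite /H_edge /= prednK ?muln_gt0 // !eqxx.
have c0 (h0 : 0 < n) w : connect H_edge (cnode (Ordinal h0)) w.
  case: w => [[[i hi]|[[i hi] s]]|[[[i hi] [j hj]] k]]; first exact: cc.
    apply: connect_trans (cc i h0 hi) (connect1 _).
    by rewrite /H_edge /= eqxx.
  have hi' : i < n by apply: leq_trans hi (leq_pred n).
  apply: connect_trans (cc i h0 hi') _.
  exact: (cb (Ordinal hi') (Ordinal hi) j hj k (erefl _)).
have h0 : 0 < n.
  case: u => [[[i hi]|[[i hi] s]]|[[[i hi] j] k]].
  - exact: leq_trans hi.
  - exact: leq_trans hi.
  - by apply: leq_trans (leq_pred n); apply: leq_trans hi.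
by apply: connect_trans (c0 h0 v); rewrite csym.
Qed.

Definition H_graph : cgraph := CGraph H_edge_sym H_edge_irr H_edge_connected.

End GraphH.

Arguments H_graph M n M_gt0 : clear implicits.

(* Main.v *)
(* Both parameters are bounded in terms of M alone, because H is quasi-isometric
   to a line. With probability 1 - O(1/n), the points x, y, z are leaves a_{i,s}
   attached to distinct junctions. The median junction then lies on all three
   sides, so minsize = 0. Moreover slim <= M, with equality as soon as, on one
   of the cycles between the extreme junctions, the long side and the short side
   crossing this cycle take different arcs: the middle of the arc of the long
   side is then at distance M from the other two sides. Given the short sides,
   at most one of the 2^gap or more long sides avoids this, and 2^-gap averages
   to O(1/n). *)
Require Import Defs.
From mathcomp Require Import all_boot all_order all_algebra.
From mathcomp Require Import reals topology normedtype.
From mathcomp Require Import zify ring lra.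

Set Implicit Arguments.
Unset Strict Implicit.
Unset Printing Implicit Defensive.

(** * Geodesics in a connected graph *)

Section Distance.
Variable G : cgraph.
Implicit Types (x y z u v w : G) (s : seq G).

Lemma dist_last x s : path (@edge G) x s -> dist x (last x s) <= size s.
Proof.
move=> es; rewrite /dist; case: ex_minnP => m _; apply.
by apply/existsP; exists (in_tuple s); rewrite es eqxx.
Qed.

Lemma shortest_path x y :
  exists2 s, path (@edge G) x s & last x s = y /\ size s = dist x y.
Proof.
rewrite /dist; case: ex_minnP => m /existsP [p /andP [ep /eqP lp]] _.
by exists (val p); rewrite ?size_tuple.
Qed.

Lemma card_geodesic_gt0 x y : 0 < #|geodesic x y|.
Proof.
have [s es [ls ss]] := shortest_path x y.
have ss' : size s == dist x y by apply/eqP.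
have ok : path (@edge G) x (Tuple ss') && (last x (Tuple ss') == y).
  by rewrite /= es ls eqxx.
by apply/card_gt0P; exists (Sub (Tuple ss') ok).
Qed.

Lemma dist_xx x : dist x x = 0.
Proof. by apply/eqP; rewrite -leqn0; apply: (@dist_last x [::]). Qed.

Lemma dist_edge x y : edge x y -> dist x y <= 1.
Proof. by move=> exy; apply: (@dist_last x [:: y]); rewrite /= exy. Qed.

Lemma dist_triangle y x z : dist x z <= dist x y + dist y z.
Proof.
have [s es [ls <-]] := shortest_path x y.
have [t et [lt <-]] := shortest_path y z.
by rewrite -size_cat -lt -ls -last_cat dist_last // cat_path es ls.
Qed.

Lemma dist_sym x y : dist x y = dist y x.
Proof.
suff le u v : dist u v <= dist v u by apply/eqP; rewrite eqn_leq !le.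
have [s es [ls <-]] := shortest_path v u.
have e' : path (@edge G) (last v s) (rev (belast v s)).
  by rewrite rev_path (eq_path (e' := @edge G)) // => a b; rewrite edge_sym.
have := dist_last e'; rewrite size_rev size_belast -ls.
suff -> : last (last v s) (rev (belast v s)) = v by [].
by case: {e' ls es} s => //= a s; rewrite rev_cons last_rcons.
Qed.

(** Main source of lower bounds on distances: each edge of a shortest path raises [F] by at most
    1. *)
Lemma lipschitz_dist (F : G -> nat) u v :
  (forall a b, edge a b -> F b <= F a + 1) -> F v <= F u + dist u v.
Proof.
move=> lipF; have [s es [<- <-]] := shortest_path u v.
elim: s u es => [|a s IH] u /=; first by rewrite addn0.
move=> /andP [/lipF eua /IH]; lia.
Qed.

Lemma path_exit (P : pred G) x s :
  path (@edge G) x s -> P x -> ~~ P (last x s) ->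
  exists u w, [/\ edge u w, P u, ~~ P w, u \in x :: s & w \in x :: s].
Proof.
elim: s x => [|a s IH] x /=; first by move=> _ ->.
move=> /andP [exa es] Px nP.
have [Pa|nPa] := boolP (P a).
  have [u [w [euw Pu Pw us ws]]] := IH a es Pa nP.
  by exists u, w; split; rewrite // inE ?us ?ws orbT.
by exists x, a; split; rewrite // !inE eqxx ?orbT.
Qed.

Lemma geodesicP x y (p : geodesic x y) :
  [/\ path (@edge G) x (val p), last x (val p) = y
    & size (val p) = dist x y].
Proof.
by have /andP [ep /eqP lp] := valP p; split; rewrite ?size_tuple.
Qed.

Lemma side_right x y (p : geodesic x y) : y \in side p.
Proof. by have [_ lp _] := geodesicP p; rewrite inE -{1}lp mem_last. Qed.

Lemma dist_nth_geodesic x y (p : geodesic x y) t : t <= dist x y ->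
  dist x (nth x (x :: val p) t) = t /\
  dist (nth x (x :: val p) t) y = dist x y - t.
Proof.
have [ep lp sp] := geodesicP p => t_le.
set v := nth _ _ t.
have lv : v = last x (take t (val p)).
  rewrite /v; case: t t_le {v} => [|t] t_le; first by rewrite take0.
  by rewrite -nth_last size_takel ?sp //= nth_take // (set_nth_default x) ?sp.
have ev := ep; rewrite -(cat_take_drop t (val p)) cat_path -lv in ev.
case/andP: ev => e1 e2.
have := dist_last e1; rewrite -lv size_takel ?sp // => d1.
have := dist_last e2; rewrite {2}lv -last_cat cat_take_drop lp size_drop sp.
move=> d2.
have := dist_triangle v x y; lia.
Qed.

(** On a geodesic, the position of a vertex is its distance from [x], so this distance recovers the
    vertex. *)
Lemma side_nthP x y (p : geodesic x y) v :
  v \in side p -> dist x v <= dist x y /\ v = nth x (x :: val p) (dist x v).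
Proof.
have [ep lp sp] := geodesicP p.
rewrite inE => /(nthP x) [t]; rewrite [size _]/= ltnS sp => t_le <-.
by have [-> _] := dist_nth_geodesic p t_le.
Qed.

Lemma nth_side x y (p : geodesic x y) t :
  t <= dist x y -> nth x (x :: val p) t \in side p.
Proof.
by have [_ _ sp] := geodesicP p => t_le; rewrite inE mem_nth //= sp.
Qed.

Lemma dist_side x y (p : geodesic x y) v :
  v \in side p -> dist x v + dist v y = dist x y.
Proof.
move=> /side_nthP [d_le ev]; have [_] := dist_nth_geodesic p d_le.
by rewrite -ev; lia.
Qed.

Lemma side_inj x y (p : geodesic x y) u v :
  u \in side p -> v \in side p -> dist x u = dist x v -> u = v.
Proof.
by move=> /side_nthP [_ eu] /side_nthP [_ ev] duv; rewrite eu ev duv.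
Qed.

Lemma side_edge x y (p : geodesic x y) u v :
  u \in side p -> v \in side p -> dist x v = (dist x u).+1 -> edge u v.
Proof.
move=> /side_nthP [_ eu] /side_nthP [v_le ev] duv.
have [ep _ sp] := geodesicP p.
have := pathP x ep (dist x u); rewrite sp -duv => /(_ v_le).
have -> : nth x (val p) (dist x u) = v by rewrite [RHS]ev duv.
by rewrite -eu.
Qed.

(** A side has exactly one vertex at each distance from [x], so inclusion of vertex sets already
    forces equality of the sequences. *)
Lemma geodesic_eq x y (p q : geodesic x y) : side p \subset side q -> p = q.
Proof.
move=> /subsetP sub; apply: val_inj; apply: val_inj.
have [_ _ sp] := geodesicP p; have [_ _ sq] := geodesicP q.
apply: (@eq_from_nth _ x); rewrite sp ?sq // => t t_lt.
have [_] := side_nthP (sub _ (nth_side p t_lt)).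
by have [-> _] := dist_nth_geodesic p t_lt.
Qed.

(** Discrete intermediate value theorem: on an edge where [F] passes the threshold [t], it moves by
    at most 1 and cannot jump over [t]. *)
Lemma path_level (F : G -> nat) t x s :
  (forall a b, edge a b -> F b <= F a + 1) -> path (@edge G) x s ->
  minn (F x) (F (last x s)) <= t <= maxn (F x) (F (last x s)) ->
  exists2 w, w \in x :: s & F w = t.
Proof.
move=> lipF es t_in.
have [e|ne] := eqVneq (F x) t; first by exists x; rewrite ?mem_head.
have [lt|ge] := ltnP (F x) t.
  have nl : ~~ (F (last x s) < t) by lia.
  have [u [w [euw Pu Pw us ws]]] := path_exit (P := fun v => F v < t) es lt nl.
  exists w => //; have := lipF _ _ euw; lia.
have gt : t < F x by lia.
have nl : ~~ (t < F (last x s)) by lia.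
have [u [w [euw Pu Pw us ws]]] := path_exit (P := fun v => t < F v) es gt nl.
exists w => //; rewrite edge_sym in euw; have := lipF _ _ euw; lia.
Qed.

Lemma side_level (F : G -> nat) t x y (p : geodesic x y) :
  (forall a b, edge a b -> F b <= F a + 1) ->
  minn (F x) (F y) <= t <= maxn (F x) (F y) ->
  exists2 w, w \in side p & F w = t.
Proof.
have [ep lp _] := geodesicP p => lipF t_in.
have [|w wp Fw] := path_level (t := t) lipF ep; first by rewrite lp.
by exists w; rewrite ?inE.
Qed.

(** * Upper bounds for diameters, slimness and minsize *)

Lemma diam_le (A : {set G}) m :
  (forall u v, u \in A -> v \in A -> dist u v <= m) -> diam A <= m.
Proof.
by move=> le; apply/bigmax_leqP => u uA; apply/bigmax_leqP => v; apply: le.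
Qed.

Lemma coveredP (A B : {set G}) m :
  reflect (forall u, u \in A -> exists2 v, v \in B & dist u v <= m)
          (covered A B m).
Proof.
apply: (iffP 'forall_implyP) => cov u uA.
  by have /existsP [v /andP [vB d]] := cov u uA; exists v.
by have [v vB d] := cov u uA; apply/existsP; exists v; rewrite vB.
Qed.

Lemma coveredW (A B : {set G}) m m' :
  m <= m' -> covered A B m -> covered A B m'.
Proof.
move=> le /coveredP cov; apply/coveredP => u /cov [v vB d]; exists v => //.
exact: leq_trans le.
Qed.

Section Triangle.
Variables (x y z : G) (p : geodesic x y) (q : geodesic y z) (r : geodesic z x).

Lemma slim_le m :
  covered (side p) (side q :|: side r) m ->
  covered (side q) (side r :|: side p) m ->
  covered (side r) (side p :|: side q) m -> slim p q r <= m.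
Proof.
move=> c1 c2 c3; rewrite /slim; case: ex_minnP => k _; apply.
exact/and3P.
Qed.

Lemma covered_slim :
  [/\ covered (side p) (side q :|: side r) (slim p q r),
      covered (side q) (side r :|: side p) (slim p q r)
    & covered (side r) (side p :|: side q) (slim p q r)].
Proof. by rewrite /slim; case: ex_minnP => k /and3P []. Qed.

Lemma minsize_le u v w m : u \in side q -> v \in side r -> w \in side p ->
  dist u v <= m -> dist v w <= m -> dist u w <= m -> minsize p q r <= m.
Proof.
move=> uq vr wp duv dvw duw; rewrite /minsize; case: ex_minnP => k _ min.
apply: leq_trans (min (diam [set u; v; w]) _) _.
  apply/existsP; exists u; rewrite uq; apply/existsP; exists v; rewrite vr.
  by apply/existsP; exists w; rewrite wp eqxx.
apply: diam_le => a b; rewrite !inE.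
by move=> /orP [/orP [] /eqP ->|/eqP ->] /orP [/orP [] /eqP ->|/eqP ->];
  rewrite ?dist_xx // dist_sym.
Qed.

End Triangle.

(* A function [F] with the two properties below makes [G] quasi-isometric
   to a line; this bounds both parameters uniformly over all triangles. *)
Section LineLike.
Variables (F : G -> nat) (C : nat).
Hypothesis lipF : forall a b, edge a b -> F b <= F a + 1.
Hypothesis dist_leF : forall u v, dist u v <= (F u - F v) + (F v - F u) + C.

(** Distances are [F]-differences up to an additive error [C], so along a geodesic [F] leaves the
    interval between its end values by at most [C / 2]. Another side meets the nearest level of that
    interval, at the cost of one more [C]. *)
Lemma covered_line x y z (p : geodesic x y) (q : geodesic y z)
    (r : geodesic z x) : covered (side p) (side q :|: side r) (2 * C).
Proof.
apply/coveredP => v vp.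
have lip u w := lipschitz_dist u w lipF.
have := dist_side vp; have := dist_leF x y.
have := lip x v; have := lip v x; have := lip v y; have := lip y v.
rewrite (dist_sym v x) (dist_sym y v) => l1 l2 l3 l4 d1 d2.
(* [t] is [F v] clamped to the interval between [F x] and [F y]; the ranges of [F] on the other two
   sides together cover this interval. *)
pose t := maxn (minn (F x) (F y)) (minn (F v) (maxn (F x) (F y))).
suff [w wqr Fw] : exists2 w, w \in side q :|: side r & F w = t.
  by exists w => //; have := dist_leF v w; rewrite Fw /t; lia.
have [tq|tq] := boolP (minn (F y) (F z) <= t <= maxn (F y) (F z)).
  by have [w wq Fw] := side_level q lipF tq; exists w; rewrite // inE wq.
have tr : minn (F z) (F x) <= t <= maxn (F z) (F x).
  by move: tq; rewrite /t; lia.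
by have [w wr Fw] := side_level r lipF tr; exists w; rewrite // inE wr orbT.
Qed.

Lemma slim_line x y z (p : geodesic x y) (q : geodesic y z)
    (r : geodesic z x) : slim p q r <= 2 * C.
Proof. by apply: slim_le; apply: covered_line. Qed.

(** The corner with the median value of [F] lies on two sides, and the third side passes through its
    level. *)
Lemma minsize_line x y z (p : geodesic x y) (q : geodesic y z)
    (r : geodesic z x) : minsize p q r <= C.
Proof.
have near u v : F u = F v -> dist u v <= C by have := dist_leF u v; lia.
have [xm|xm] := boolP (minn (F y) (F z) <= F x <= maxn (F y) (F z)).
  have [w wq Fw] := side_level q lipF xm.
  by apply: (minsize_le wq (side_right r) (side_left p)); apply: near.
have [ym|ym] := boolP (minn (F z) (F x) <= F y <= maxn (F z) (F x)).
  have [w wr Fw] := side_level r lipF ym.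
  by apply: (minsize_le (side_left q) wr (side_right p)); apply: near.
have zm : minn (F x) (F y) <= F z <= maxn (F x) (F y) by lia.
have [w wp Fw] := side_level p lipF zm.
by apply: (minsize_le (side_right q) (side_left r) wp); apply: near.
Qed.

End LineLike.
End Distance.

(** * The graph H *)

Section GraphH.
Variables (M n : nat) (M_gt0 : 0 < M).
Local Notation G := (H_graph M n M_gt0).
Local Notation L := (2 * M).+1.
Implicit Types (u v w : G).

(** Cycle [m] joins the junctions [lnode m] and [rnode m]; each of its two arcs has [L] edges. *)
Definition lnode (m : 'I_n.-1) : 'I_n := widen_ord (leq_pred n) m.

Lemma rnode_subproof (m : 'I_n.-1) : m.+1 < n.
Proof. by case: n m => [|k] []. Qed.

Definition rnode (m : 'I_n.-1) : 'I_n := Ordinal (rnode_subproof m).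

(** Inversion of [H_arc]: equalities between indices of different ordinal types are absorbed into
    [lnode] and [rnode], so that case analysis substitutes the endpoints. *)
Variant arc_spec : H_vertex M n -> H_vertex M n -> Prop :=
  | ArcCA i s : arc_spec (cnode M i) (anode i s)
  | ArcCB m (j : 'I_(2 * M)) k : j = 0 :> nat ->
      arc_spec (cnode M (lnode m)) (bnode m j k)
  | ArcBB m (j j' : 'I_(2 * M)) k : j' = j.+1 :> nat ->
      arc_spec (bnode m j k) (bnode m j' k)
  | ArcBC m (j : 'I_(2 * M)) k : j.+1 = 2 * M :> nat ->
      arc_spec (bnode m j k) (cnode M (rnode m)).

Lemma arcP u v : H_arc u v -> arc_spec u v.
Proof.
move: u v => [[i|[i s]]|[[i j] k]] [[i'|[i' s']]|[[i' j'] k']] //=.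
- by move=> /eqP ->; apply: ArcCA.
- case/andP=> /eqP ii' /eqP j0.
  by rewrite (_ : i = lnode i'); [apply: ArcCB | apply: val_inj].
- case/andP=> /eqP jM /eqP ii'.
  by rewrite (_ : i' = rnode i); [apply: ArcBC | apply: val_inj].
- by case/and3P=> /eqP <- /eqP <- /eqP jj'; apply: ArcBB.
Qed.

Lemma lipschitz_arc (F : G -> nat) :
  (forall u v, arc_spec u v -> F v <= F u + 1 /\ F u <= F v + 1) ->
  forall u v, edge u v -> F v <= F u + 1.
Proof. by move=> lipF u v /orP [] /arcP /lipF []. Qed.

(** Position along the chain of cycles, the function that makes the graph quasi-isometric to a line;
    a leaf inherits the position of its junction. *)
Definition level v : nat :=
  match v with
  | inl (inl i) => L * i
  | inl (inr (i, _)) => L * i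
  | inr (m, j, _) => L * m + j.+1
  end.

Definition leaf v : bool := if v is inl (inr _) then true else false.

Lemma level_lipschitz u v : edge u v -> level v <= level u + 1.
Proof.
by apply: lipschitz_arc => a b [] /= *; split; nia.
Qed.

Lemma level_inj a b r r' :
  r < L -> r' < L -> L * a + r = L * b + r' -> a = b /\ r = r'.
Proof.
move=> rL r'L e; have : (L * a + r) %/ L = (L * b + r') %/ L by rewrite e.
rewrite !(mulnC L) !divnMDl // !divn_small // !addn0 => ab.
by split=> //; move: e; rewrite ab; lia.
Qed.

Lemma levelC w (i : 'I_n) : level w = L * i -> ~~ leaf w -> w = cnode M i.
Proof.
case: w => [[i'|[]]|[[m j] k]] //= e _.
  congr (inl (inl _)); apply: val_inj.
  by move/eqP: e; rewrite eqn_mul2l => /eqP.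
have jL : j.+1 < L by rewrite ltnS ltn_ord.
by rewrite -[RHS]addn0 in e; have [_] := level_inj jL (ltn0Sn _) e.
Qed.

Lemma levelB w (m : 'I_n.-1) (j : 'I_(2 * M)) :
  level w = L * m + j.+1 -> exists k, w = bnode m j k.
Proof.
have jL (l : 'I_(2 * M)) : l.+1 < L by rewrite ltnS ltn_ord.
case: w => [[i'|[i' s]]|[[m' j'] k]] /= e.
- by rewrite -[LHS]addn0 in e; have [_] := level_inj (ltn0Sn _) (jL j) e.
- by rewrite -[LHS]addn0 in e; have [_] := level_inj (ltn0Sn _) (jL j) e.
have [mm [jj]] := level_inj (jL j') (jL j) e.
by exists k; congr (inr (_, _, _)); apply: val_inj.
Qed.

Lemma level_leC a b r : r < L -> L * a <= L * b + r -> a <= b.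
Proof. by move=> rL le; rewrite leqNgt; apply/negP => ba; nia. Qed.

Lemma level_ltC a b r : 0 < r -> L * b + r <= L * a -> b < a.
Proof. by move=> r0 le; rewrite ltnNge; apply/negP => ab; nia. Qed.

(** * Distances between nodes of the chain *)

Lemma dist_anode_cnode i (s : 'I_(M * n)) :
  dist (anode i s : G) (cnode M i) <= 1.
Proof. by apply: dist_edge; rewrite /edge /= /H_edge /= eqxx. Qed.

Lemma dist_lnode m (j : 'I_(2 * M)) k :
  dist (cnode M (lnode m) : G) (bnode m j k) <= j.+1.
Proof.
case: j => j hj /=; elim: j hj => [|j IH] hj.
  by apply: dist_edge; rewrite /edge /= /H_edge /= eqxx.
apply: leq_trans (dist_triangle (bnode m (Ordinal (ltnW hj)) k : G) _ _) _.
rewrite -[j.+2]addn1 leq_add ?IH //.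
by apply: dist_edge; rewrite /edge /= /H_edge /= !eqxx.
Qed.

Lemma dist_rnode m (j : 'I_(2 * M)) k :
  dist (bnode m j k : G) (cnode M (rnode m)) <= 2 * M - j.
Proof.
case: j => j hj /=; move e : (2 * M - j) => d.
elim: d j hj e => [|d IH] j hj e; first by lia.
have [jM|jM] := leqP (2 * M) j.+1.
  apply: leq_trans (dist_edge _) _ => //.
  by rewrite /edge /= /H_edge /= eqxx andbT eqn_leq jM hj.
apply: leq_trans (dist_triangle (bnode m (Ordinal jM) k : G) _ _) _.
rewrite -[d.+1]add1n leq_add ?IH //; last by lia.
by apply: dist_edge; rewrite /edge /= /H_edge /= !eqxx.
Qed.

Lemma dist_cnode (i i' : 'I_n) :
  dist (cnode M i : G) (cnode M i') <= L * ((i - i') + (i' - i)).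
Proof.
wlog ii' : i i' / i <= i'.
  move=> W; have [/W //|/ltnW /W] := leqP i i'.
  by rewrite dist_sym addnC.
rewrite (eqP ii') add0n.
move e : (i' - i) => d; elim: d i' ii' e => [|d IH] i' ii' e.
  by rewrite (_ : i' = i) ?dist_xx //; apply: val_inj => /=; lia.
have hm : i'.-1 < n.-1 by have := ltn_ord i'; lia.
pose m := Ordinal hm.
have ri' : rnode m = i' by apply: val_inj => /=; lia.
apply: leq_trans (dist_triangle (cnode M (lnode m) : G) _ _) _.
rewrite mulnS addnC leq_add ?IH //=; try lia.
have hj : 0 < 2 * M by lia.
apply: leq_trans (dist_triangle (bnode m (Ordinal hj) ord0 : G) _ _) _.
have := dist_lnode m (Ordinal hj) ord0; have := dist_rnode m (Ordinal hj) ord0.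
rewrite ri' /=; lia.
Qed.

(** Each vertex is within [2 * M] of a junction whose level is lower by at most [2 * M]. The two
    detours cost [4 * M], and replacing levels of junctions by those of [u] and [v] costs another
    [2 * M]. *)
Lemma dist_level u v :
  dist u v <= (level u - level v) + (level v - level u) + 6 * M.
Proof.
have near w : exists i : 'I_n, [/\ dist w (cnode M i) <= 2 * M,
    L * i <= level w & level w <= L * i + 2 * M].
  case: w => [[i|[i s]]|[[m j] k]].
  - by exists i; rewrite dist_xx; split=> //=; lia.
  - exists i; split=> /=; try lia.
    by apply: leq_trans (dist_anode_cnode i s) _; lia.
  - exists (lnode m); split=> /=; first rewrite dist_sym.
    + exact: leq_trans (dist_lnode m j k) (ltn_ord j).
    + exact: leq_addr.
    + by rewrite leq_add2l.
have [i [di i1 i2]] := near u; have [i' [di' i1' i2']] := near v.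
have := dist_cnode i i'; have := dist_triangle (cnode M i : G) u v.
have := dist_triangle (cnode M i' : G) (cnode M i) v.
rewrite (dist_sym (cnode M i' : G) v) mulnDr !mulnBr.
move: (L * i) (L * i') i1 i2 i1' i2' di di' => a b.
lia.
Qed.

Lemma slim_bound (x y z : G) (p : geodesic x y) (q : geodesic y z)
    (r : geodesic z x) : slim p q r <= 12 * M.
Proof.
by have := slim_line level_lipschitz dist_level p q r; rewrite mulnA.
Qed.

Lemma minsize_bound (x y z : G) (p : geodesic x y) (q : geodesic y z)
    (r : geodesic z x) : minsize p q r <= 6 * M.
Proof. by have := minsize_line level_lipschitz dist_level p q r. Qed.

Lemma anode_inj i i' (s s' : 'I_(M * n)) : anode i s = anode i' s' -> i = i'.
Proof. by case. Qed.

Lemma edge_anode i s w : edge (anode i s : G) w -> w = cnode M i.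
Proof. by case: w => [[i'|[i' s']]|[[m j] k]] /orP [] //= /eqP ->. Qed.

(** Leaving the leaf takes one edge, each unit of level takes one more, and entering another leaf
    takes a last one. *)
Lemma dist_anode i s v : v != anode i s ->
  (L * i - level v) + (level v - L * i) + leaf v + 1 <= dist (anode i s : G) v.
Proof.
move=> vx.
pose F w := if w == anode i s :> G then 0 else
  (L * i - level w) + (level w - L * i) + leaf w + 1.
have lipF a b : edge a b -> F b <= F a + 1.
  apply: lipschitz_arc => {}a {}b ab; rewrite /F.
  have nc l : (cnode M l == anode i s :> G) = false by [].
  have nb m j k : (bnode m j k == anode i s :> G) = false by [].
  case: ab => [i' s'|m j k j0|m j j' k jj'|m j k jM];
    rewrite ?nc ?nb /=; try nia.
  by case: eqVneq => [/anode_inj <-|_] /=; lia.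
have := lipschitz_dist (anode i s : G) v lipF.
by rewrite {2}/F eqxx /F (negPf vx).
Qed.

Lemma dist_anodes i s i' s' :
  dist (anode i s : G) (anode i' s') <= L * ((i - i') + (i' - i)) + 2.
Proof.
have := dist_cnode i i'; have := dist_anode_cnode i s.
have := dist_anode_cnode i' s'.
have := dist_triangle (cnode M i : G) (anode i s) (anode i' s').
have := dist_triangle (cnode M i' : G) (cnode M i) (anode i' s').
rewrite (dist_sym (cnode M i' : G) (anode i' s')); lia.
Qed.

(** * Shape of the geodesics between two leaves *)

Section LeafGeodesic.
Variables (i i' : 'I_n) (s s' : 'I_(M * n)).
Local Notation x := (anode i s : G).
Local Notation y := (anode i' s' : G).
Variable p : geodesic x y.

(** The lower bounds for the distances from [v] to both ends add up to at least the upper bound for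
    [dist x y]; hence they are equalities, which leaves no room for a leaf or for a level outside
    the range. *)
Lemma inner_vertex v : v \in side p -> v != x -> v != y ->
  [/\ ~~ leaf v, minn (L * i) (L * i') <= level v <= maxn (L * i) (L * i')
    & dist x v = (L * i - level v) + (level v - L * i) + 1].
Proof.
move=> vp vx vy; have := dist_side vp.
have := dist_anode vx; have := dist_anode vy; have := dist_anodes i s i' s'.
rewrite (dist_sym y v).
have := leq_total i i'; case: (leaf v) => le d1 d2 d3 e; split; nia.
Qed.

Lemma bnode_inner m j k : bnode m j k \in side p ->
  [/\ minn i i' <= m, m < maxn i i'
    & dist x (bnode m j k) =
        (L * i - (L * m + j.+1)) + (L * m + j.+1 - L * i) + 1].
Proof.
move=> /inner_vertex [] // _ /= /andP [h1 h2] ->; split=> //.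
  by rewrite -minnMr in h1; apply: level_leC h1; rewrite ltnS ltn_ord.
by rewrite -maxnMr in h2; apply: level_ltC h2.
Qed.

Hypothesis ii' : i != i'.

(** An end junction is the only neighbour of its leaf; any other junction in the range is the only
    vertex of its level that is not a leaf. *)
Lemma cnode_side (m : 'I_n) :
  minn i i' <= m <= maxn i i' -> cnode M m \in side p.
Proof.
move=> m_in.
have xy : x != y by apply: contra ii' => /eqP/anode_inj ->.
have [ep lp _] := geodesicP p.
have [->|mi] := eqVneq m i.
  have [|u [w [euw /eqP ux _ _ wp]]] :=
      path_exit (P := pred1 x) ep (eqxx _).
    by rewrite lp /= eq_sym.
  by rewrite ux in euw; rewrite inE -(edge_anode euw).
have [->|mi'] := eqVneq m i'.
  have [|u [w [euw uy + up _]]] := path_exit (P := predC1 y) ep xy.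
    by rewrite lp /= eqxx.
  rewrite /= negbK => /eqP wy.
  by rewrite edge_sym wy in euw; rewrite inE -(edge_anode euw).
have [|w wp lw] := side_level (t := L * m) p level_lipschitz.
  by rewrite /= -minnMr -maxnMr !leq_pmul2l.
have nl (l : 'I_n) t : m != l -> w != anode l t.
  apply: contra => /eqP e; move: lw; rewrite e /= => /eqP.
  by rewrite eqn_pmul2l // eq_sym.
have [lf _ _] := inner_vertex wp (nl _ _ mi) (nl _ _ mi').
by rewrite -(levelC lw lf).
Qed.

Lemma bnode_side (m : 'I_n.-1) (j : 'I_(2 * M)) :
  minn i i' <= m < maxn i i' -> exists k, bnode m j k \in side p.
Proof.
move=> m_in.
have [|w wp lw] := side_level (t := L * m + j.+1) p level_lipschitz.
  rewrite /= -minnMr -maxnMr; have := ltn_ord j; nia.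
by have [k ek] := levelB lw; exists k; rewrite -ek.
Qed.

(** Consecutive levels are at consecutive distances from [x], so the two nodes are adjacent, and no
    edge joins nodes of different arcs. *)
Lemma bnode_adjacent m (j j' : 'I_(2 * M)) k k' : j' = j.+1 :> nat ->
  bnode m j k \in side p -> bnode m j' k' \in side p -> k = k'.
Proof.
move=> jj' bp bp'.
have [m1 m2 d] := bnode_inner bp; have [_ _ d'] := bnode_inner bp'.
(* The direction of travel depends on whether [x] is left or right of the cycle. *)
have [im|im] := leqP i m.
  have : edge (bnode m j k : G) (bnode m j' k').
    by apply: (side_edge bp bp'); rewrite d d' jj'; nia.
  by move=> /orP [] /= /and3P [_ /eqP ->].
have : edge (bnode m j' k' : G) (bnode m j k).
  apply: (side_edge bp' bp); rewrite d d' jj'; have := ltn_ord j'; nia.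
by move=> /orP [] /= /and3P [_ /eqP ->].
Qed.

(** By adjacency both nodes can be followed down to the first nodes of their arcs; these are at the
    same distance from [x], hence equal. *)
Lemma bnode_unique m (j j' : 'I_(2 * M)) k k' :
  bnode m j k \in side p -> bnode m j' k' \in side p -> k = k'.
Proof.
have hj0 : 0 < 2 * M by lia.
suff down j1 k1 : bnode m j1 k1 \in side p ->
    bnode m (Ordinal hj0) k1 \in side p.
  move=> /down bp /down bp'.
  have [_ _ d] := bnode_inner bp; have [_ _ d'] := bnode_inner bp'.
  by have [] := side_inj bp bp' (etrans d (esym d')).
case: j1 => j1 hj; elim: j1 k1 hj => [|j1 IH] k1 hj bp.
  by rewrite (bool_irrelevance hj0 hj).
have [m1 m2 _] := bnode_inner bp.
have [|k2 bp2] := @bnode_side m (Ordinal (ltnW hj)); first by rewrite m1.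
rewrite -(@bnode_adjacent m (Ordinal (ltnW hj)) (Ordinal hj) k2 k1) //.
exact: IH bp2.
Qed.

Lemma bnode_arc m (j j' : 'I_(2 * M)) k :
  bnode m j k \in side p -> bnode m j' k \in side p.
Proof.
move=> bp; have [m1 m2 _] := bnode_inner bp.
have [|k' bp'] := @bnode_side m j'; first by rewrite m1.
by rewrite (bnode_unique bp bp').
Qed.


End LeafGeodesic.

Lemma mid_subproof : M.-1 < 2 * M.
Proof. by lia. Qed.

(** With indices from 0, this is the node of an arc at distance [M] from the left junction and
    [M + 1] from the right one. *)
Definition mid : 'I_(2 * M) := Ordinal mid_subproof.

Lemma dist_mid m k (w : G) : dist (bnode m mid k : G) w < M ->
  exists j, w = bnode m j k.
Proof.
(* [F] measures the distance to the outside of the arc [k] of cycle [m]; it equals [M] at the middle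
   node. *)
pose F (v : G) := if v is inr (m', j, k') then
  if (m' == m) && (k' == k) then minn j.+1 (2 * M - j) else 0 else 0.
have lipF a b : edge a b -> F b <= F a + 1.
  apply: lipschitz_arc => {}a {}b [i s|m' j k' j0|m' j j' k' jj'|m' j k' jM];
    rewrite /F //=; case: (_ && _); lia.
have lipF' := lipschitz_dist w (bnode m mid k : G) lipF.
rewrite dist_sym => near; have : 0 < F w.
  have : F (bnode m mid k) = M by rewrite /F /= !eqxx /=; lia.
  by move: lipF'; lia.
rewrite /F; case: w {near lipF'} => // [[[m' j] k']].
by case: andP => // -[/eqP -> /eqP ->] _; exists j.
Qed.

(** * Triangles on leaves of three distinct junctions *)

Section Triangle.
Variables (i1 i2 i3 : 'I_n) (s1 s2 s3 : 'I_(M * n)).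
Local Notation x := (anode i1 s1 : G).
Local Notation y := (anode i2 s2 : G).
Local Notation z := (anode i3 s3 : G).
Hypotheses (i12 : i1 != i2) (i23 : i2 != i3) (i31 : i3 != i1).
Variables (q : geodesic y z) (r : geodesic z x).

Lemma cnode_sides (i : 'I_n) : minn i1 i2 <= i <= maxn i1 i2 ->
  cnode M i \in side q :|: side r.
Proof.
move=> i_in; rewrite inE.
have [/(cnode_side q i23) -> //|nq] := boolP (minn i2 i3 <= i <= maxn i2 i3).
by rewrite orbC (cnode_side r i31) //; lia.
Qed.

(** Junctions of [p] lie on the other two sides, and every node of an arc is within [M] of one end
    of the arc. *)
Lemma covered_anodes (p : geodesic x y) :
  covered (side p) (side q :|: side r) M.
Proof.
apply/coveredP => v vp.
have [->|vx] := eqVneq v x.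
  by exists x; rewrite ?dist_xx // inE side_right orbT.
have [->|vy] := eqVneq v y.
  by exists y; rewrite ?dist_xx // inE side_left.
have [lf v_in _] := inner_vertex vp vx vy.
case: v vp vx vy lf v_in => [[i|[i s]]|[[m j] k]] // vp _ _ _.
  rewrite /= -minnMr -maxnMr !leq_pmul2l // => i_in.
  by exists (cnode M i); rewrite ?cnode_sides ?dist_xx.
have [m1 m2 _] := bnode_inner vp => _.
have [jM|jM] := ltnP j M.
  exists (cnode M (lnode m)); first by apply: cnode_sides => /=; lia.
  rewrite dist_sym; exact: leq_trans (dist_lnode m j k) jM.
exists (cnode M (rnode m)); first by apply: cnode_sides => /=; lia.
by apply: leq_trans (dist_rnode m j k) _; lia.
Qed.

Lemma minsize_anodes (p : geodesic x y) : minsize p q r = 0.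
Proof.
(* The witness is the median of the three junctions. *)
have [i [h12 h23 h31]] : exists i : 'I_n, [/\ minn i1 i2 <= i <= maxn i1 i2,
    minn i2 i3 <= i <= maxn i2 i3 & minn i3 i1 <= i <= maxn i3 i1].
  have [h|h] := boolP (minn i1 i2 <= i3 <= maxn i1 i2).
    by exists i3; split; lia.
  have [h'|h'] := boolP (minn i2 i3 <= i1 <= maxn i2 i3).
    by exists i1; split; lia.
  by exists i2; split; lia.
apply/eqP; rewrite -leqn0.
by apply: (minsize_le (cnode_side q i23 h23) (cnode_side r i31 h31)
  (cnode_side p i12 h12)); rewrite dist_xx.
Qed.

(* If [p] passes through the arc [k] of a cycle then so does [q] or [r], since
   the middle of that arc is at distance at least [M] from any vertex outside
   the arc; and only one of [q], [r] crosses that cycle, which determines [k]. *)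
Lemma covered_long_side (p p' : geodesic x y) :
  minn i1 i2 <= i3 <= maxn i1 i2 ->
  covered (side p) (side q :|: side r) M.-1 ->
  covered (side p') (side q :|: side r) M.-1 -> p = p'.
Proof.
move=> i3_in cov cov'; apply: geodesic_eq; apply/subsetP => v vp.
have arc (t : geodesic x y) m j k :
    covered (side t) (side q :|: side r) M.-1 -> bnode m j k \in side t ->
    exists j', bnode m j' k \in side q :|: side r.
  move=> /coveredP covt bt.
  have [w wqr dw] := covt _ (bnode_arc i12 mid bt).
  have [|j' ew] := @dist_mid m k w; first by move: M_gt0 dw; lia.
  by exists j'; rewrite -ew.
have uniq_qr m j j' k k' : bnode m j k \in side q :|: side r ->
    bnode m j' k' \in side q :|: side r -> k = k'.
  rewrite !in_setU => /orP [] b /orP [] b'.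
  - exact: (bnode_unique i23 b b').
  - have [] := bnode_inner b; have [] := bnode_inner b'; lia.
  - have [] := bnode_inner b; have [] := bnode_inner b'; lia.
  - exact: (bnode_unique i31 b b').
have [->|vx] := eqVneq v x; first exact: side_left.
have [->|vy] := eqVneq v y; first exact: side_right.
have [lf v_in _] := inner_vertex vp vx vy.
case: v vp vx vy lf v_in => [[i|[i s]]|[[m j] k]] // vp _ _ _.
  by rewrite /= -minnMr -maxnMr !leq_pmul2l // => /(cnode_side p' i12).
have [m1 m2 _] := bnode_inner vp => _.
have [|k' vp'] := bnode_side p' i12 j (m := m); first by rewrite m1.
have [j1 b1] := arc _ _ _ _ cov vp; have [j2 b2] := arc _ _ _ _ cov' vp'.
by rewrite [inr _](_ : _ = bnode m j k') // (uniq_qr _ _ _ _ _ b1 b2).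
Qed.

End Triangle.

(** * Number of geodesics between two leaves *)

Definition swap_arcs (A : {set 'I_n.-1}) (v : G) : G :=
  if v is inr (m, j, k) then inr (m, j, if m \in A then rev_ord k else k)
  else v.

Lemma swap_arcs_edge A : {homo swap_arcs A : u v / edge u v}.
Proof.
move=> u v /orP [] /arcP [i s|m j k j0|m j j' k jj'|m j k jM];
  by rewrite /edge /= /H_edge /= ?j0 ?jj' ?jM ?eqxx ?orbT.
Qed.

Section CardGeodesic.
Variables (i i' : 'I_n) (s s' : 'I_(M * n)).
Local Notation x := (anode i s : G).
Local Notation y := (anode i' s' : G).

Lemma swap_geodesic_subproof A (p : geodesic x y) :
  let p' := map_tuple (swap_arcs A) (val p) in
  path (@edge G) x p' && (last x p' == y).
Proof.
have [ep lp _] := geodesicP p.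
by rewrite /= (last_map (swap_arcs A) _ x) lp eqxx andbT
  (homo_path (@swap_arcs_edge A) ep).
Qed.

Definition swap_geodesic A (p : geodesic x y) : geodesic x y :=
  exist _ (map_tuple (swap_arcs A) (val p)) (swap_geodesic_subproof A p).

Lemma card_gap :
  #|[set m : 'I_n.-1 | minn i i' <= m < maxn i i']| = (i - i') + (i' - i).
Proof.
have hi_le : maxn i i' <= n.-1 by have := ltn_ord i; have := ltn_ord i'; lia.
rewrite -sum1_card; under eq_bigl do rewrite inE.
transitivity (\sum_(minn i i' <= m < maxn i i') 1).
  rewrite (big_nat_widen _ _ _ _ _ hi_le) (big_nat_widenl _ 0) // big_mkord.
  by apply: eq_bigl => m; rewrite andbC.
rewrite sum_nat_const_nat; lia.
Qed.

(* Exchanging the two arcs of some of the cycles between the endpoints maps a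
   geodesic to another one, determined by the set of these cycles. *)
Lemma card_geodesic : i != i' -> 2 ^ ((i - i') + (i' - i)) <= #|geodesic x y|.
Proof.
move=> ii'; rewrite -card_gap -card_powerset.
have /card_gt0P [p _] := card_geodesic_gt0 x y.
rewrite -(card_in_imset (f := swap_geodesic^~ p)) ?max_card // => A B.
rewrite !powersetE => /subsetP subA /subsetP subB eAB; apply/setP => m.
have [m_in|m_out] := boolP (minn i i' <= m < maxn i i'); last first.
  have := contra (subA m); have := contra (subB m).
  by rewrite inE => /(_ m_out) /negPf -> /(_ m_out) /negPf ->.
have hj : 0 < 2 * M by lia.
(* A node of cycle [m] on [p] tells the two sets apart: it is moved exactly when [m] belongs to the
   set. *)
have [k] := bnode_side p ii' (Ordinal hj) m_in; rewrite inE => kp.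
have {}eAB : map (swap_arcs A) (val p) = map (swap_arcs B) (val p).
  by have /(congr1 (fun t => val (val t))) := eAB.
have := eq_in_map (swap_arcs A) (swap_arcs B) (val p) => -[_ /(_ eAB)].
move=> /(_ (bnode m (Ordinal hj) k) kp) /= [].
have : rev_ord k != k by case: k {kp} => [[|[|]]].
by case: (m \in A); case: (m \in B) => // /eqP nk e; case: nk.
Qed.

End CardGeodesic.
End GraphH.

Import Order.TTheory GRing.Theory Num.Theory numFieldNormedType.Exports.
Local Open Scope ring_scope.

(** * Averages *)

Section Average.
Variable R : realType.

Lemma avg_le (T : finType) (F F' : T -> R) :
  (forall t, F t <= F' t) -> avg F <= avg F'.
Proof. by move=> le; rewrite ler_wpM2r ?invr_ge0 ?ler0n // ler_sum. Qed.

Lemma avgD (T : finType) (F F' : T -> R) :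
  avg (fun t => F t + F' t) = avg F + avg F'.
Proof. by rewrite /avg big_split mulrDl. Qed.

Lemma avgZ (T : finType) c (F : T -> R) :
  avg (fun t => c * F t) = c * avg F.
Proof. by rewrite /avg -mulr_sumr mulrA. Qed.

Lemma avg_const (T : finType) (c : R) :
  (0 < #|T|)%N -> avg (fun _ : T => c) = c.
Proof.
move=> T0; rewrite /avg sumr_const -[X in X / _]mulr_natr mulfK //.
by rewrite pnatr_eq0 -lt0n.
Qed.

(** The condition [0 <= c] accounts for an empty [T], on which the average is 0. *)
Lemma avg_le_const (T : finType) (F : T -> R) c :
  0 <= c -> (forall t, F t <= c) -> avg F <= c.
Proof.
move=> c0 /avg_le /le_trans; apply.
have [T0|] := posnP #|T|; last by move=> T0; rewrite avg_const.
by rewrite /avg T0 invr0 mulr0.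
Qed.

Lemma eq_avg (T : finType) (F F' : T -> R) : F =1 F' -> avg F = avg F'.
Proof. by move=> e; rewrite /avg (eq_bigr F'). Qed.

Lemma avg_exchange (T U : finType) (F : T -> U -> R) :
  avg (fun t => avg (F t)) = avg (fun u => avg (F^~ u)).
Proof. by rewrite /avg -!mulr_suml exchange_big /= mulrAC. Qed.

Lemma avg_near (T : finType) (F B : T -> R) l : (0 < #|T|)%N ->
  (forall t, `|F t - l| <= B t) -> `|avg F - l| <= avg B.
Proof.
move=> T0 near; rewrite -[l in avg F - l](avg_const l T0) /avg -mulrBl -sumrB.
rewrite normrM [`|_^-1|]ger0_norm ?invr_ge0 ?ler0n //.
rewrite ler_wpM2r ?invr_ge0 ?ler0n //.
by apply: le_trans (ler_norm_sum _ _ _) (ler_sum _ _).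
Qed.

(** An event with at most one outcome has probability at most [1 / #|T|]. *)
Lemma avg_unique (T : finType) (P : pred T) d : (2 ^ d <= #|T|)%N ->
  (forall t t', P t -> P t' -> t = t') ->
  avg (fun t => (P t)%:R) <= 2^-1 ^+ d :> R.
Proof.
move=> dT uP; have T0 : (0 < #|T|)%N by apply: leq_trans dT; rewrite expn_gt0.
rewrite /avg -natr_sum -big_mkcond sum1_card.
rewrite ler_pdivrMr ?ltr0n // exprVn mulrC.
rewrite ler_pdivlMr ?exprn_gt0 ?ltr0n // -natrX -natrM ler_nat.
apply: leq_trans dT; rewrite -[leqRHS]mul1n leq_mul2r expn_eq0 /=.
by apply/card_le1_eqP => t t' Pt Pt'; apply: uP.
Qed.

(** Conditioning on [u] and [v]: exchanging the averages puts [t] innermost, where at most one value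
    of [t] contributes. Here [t] will be the long side of a triangle. *)
Lemma avg_unique3 (T U V : finType) (f : T -> U -> V -> R)
    (P : T -> U -> V -> bool) c d : (2 ^ d <= #|T|)%N -> 0 <= c ->
  (forall t u v, f t u v <= c * (P t u v)%:R) ->
  (forall t t' u v, P t u v -> P t' u v -> t = t') ->
  avg (fun t => avg (fun u => avg (f t u))) <= c * 2^-1 ^+ d.
Proof.
move=> dT c0 fP uP; rewrite avg_exchange; have cd0 : 0 <= c * 2^-1 ^+ d :> R.
  by rewrite mulr_ge0 ?exprn_ge0 ?invr_ge0.
apply: avg_le_const => // u; rewrite (avg_exchange (f^~ u)).
apply: avg_le_const => // v; apply: le_trans (avg_le (fun t => fP t u v)) _.
rewrite avgZ ler_wpM2l //.
by apply: (@avg_unique _ (fun t => P t u v)) => // t t'; apply: uP.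
Qed.

(** The three pairs of corners have the same law, whence the factor 3. *)
Lemma E_triangle_near (G : cgraph) (f : forall x y z : G,
       geodesic x y -> geodesic y z -> geodesic z x -> nat)
    (e : G -> G -> R) c l : (0 < #|G|)%N ->
  (forall x y z, `|avg (fun p : geodesic x y => avg (fun q : geodesic y z =>
      avg (fun r : geodesic z x => (f x y z p q r)%:R))) - l|
    <= c * (e x y + e y z + e z x)) ->
  `|E_triangle R f - l| <= c * (3 * avg (fun x => avg (e x))).
Proof.
move=> G0 near.
have -> : c * (3 * avg (fun x => avg (e x))) = avg (fun x : G =>
    avg (fun y : G => avg (fun z : G => c * (e x y + e y z + e z x)))).
  have ez x y : avg (fun z => c * (e x y + e y z + e z x)) =
      c * (e x y + avg (e y) + avg (e^~ x)).
    by rewrite avgZ !avgD avg_const.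
  have ey x : avg (fun y => avg (fun z => c * (e x y + e y z + e z x))) =
      c * (avg (e x) + avg (fun y => avg (e y)) + avg (e^~ x)).
    by rewrite (eq_avg (ez x)) avgZ !avgD avg_const.
  rewrite (eq_avg ey) avgZ !avgD avg_const // -(avg_exchange e); ring.
by do 3![apply: avg_near => // ?].
Qed.

End Average.

(** * Convergence *)

Section Limit.
Variables (R : realType) (M n : nat) (M_gt0 : (0 < M)%N).
Local Notation G := (H_graph M n M_gt0).

Definition gap (i j : 'I_n) : nat := ((i - j) + (j - i))%N.

(* Equals 1 also when both leaves hang from the same junction, so that the sum
   over the three pairs is at least 1 outside the generic configuration. *)
Definition err (u v : G) : R :=
  match u, v with
  | inl (inr (i, _)), inl (inr (j, _)) => 2^-1 ^+ gap i j
  | _, _ => 1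
  end.

Lemma err_ge0 u v : 0 <= err u v.
Proof.
by case: u v => [[i|[i s]]|[[m j] k]] [[i'|[i' s']]|[[m' j'] k']] //=;
  rewrite exprn_ge0 // invr_ge0.
Qed.

Lemma err_triangle (x y z : G) :
  1 <= err x y + err y z + err z x \/
  exists i1 s1 i2 s2 i3 s3,
    [/\ x = anode i1 s1, y = anode i2 s2 & z = anode i3 s3] /\
    [/\ i1 != i2, i2 != i3 & i3 != i1].
Proof.
have := err_ge0 x y; have := err_ge0 y z; have := err_ge0 z x.
case: x => [[i1|[i1 s1]]|[[m1 j1] k1]] /=; try by left; lra.
case: y => [[i2|[i2 s2]]|[[m2 j2] k2]] /=; try by left; lra.
case: z => [[i3|[i3 s3]]|[[m3 j3] k3]] /=; try by left; lra.
have diag i j : i = j -> 2^-1 ^+ gap i j = 1 :> R.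
  by move->; rewrite /gap subnn.
have [/diag ->|n12] := eqVneq i1 i2; first by left; lra.
have [/diag ->|n23] := eqVneq i2 i3; first by left; lra.
have [/diag ->|n31] := eqVneq i3 i1; first by left; lra.
by right; exists i1, s1, i2, s2, i3, s3.
Qed.

Lemma err_sum_ge0 (x y z : G) : 0 <= err x y + err y z + err z x.
Proof. by rewrite !addr_ge0 ?err_ge0. Qed.

Lemma avg3_near (x y z : G) (f : geodesic x y -> geodesic y z ->
    geodesic z x -> nat) (l c : R) :
  avg (fun p => avg (fun q => avg (fun r => `|(f p q r)%:R - l|))) <= c ->
  `|avg (fun p => avg (fun q => avg (fun r => (f p q r)%:R))) - l| <= c.
Proof.
apply: le_trans.
by do 3![apply: avg_near => [|?]; first exact: card_geodesic_gt0].
Qed.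

(** Either the error sum is at least 1 and the uniform bound [6 * M] suffices, or [minsize]
    vanishes. The larger constant [12 * M] is shared with [slim_near]. *)
Lemma minsize_near (x y z : G) :
  `|avg (fun p : geodesic x y => avg (fun q : geodesic y z =>
      avg (fun r : geodesic z x => (minsize p q r)%:R))) - 0|
  <= (12 * M)%:R * (err x y + err y z + err z x).
Proof.
have e0 := err_sum_ge0 x y z.
apply: avg3_near.
do 3![apply: avg_le_const => [|?]; first by rewrite mulr_ge0 ?ler0n].
rewrite subr0 ger0_norm ?ler0n //.
have [e1|] := err_triangle x y z.
  apply: le_trans (_ : (12 * M)%:R <= _); last by rewrite ler_peMr ?ler0n.
  by rewrite ler_nat (leq_trans (minsize_bound _ _ _)) // leq_mul2r orbT.
move=> [i1 [s1 [i2 [s2 [i3 [s3 [[ex ey ez] [n12 n23 n31]]]]]]]].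
subst x y z; rewrite minsize_anodes //.
by rewrite mulr_ge0 ?ler0n.
Qed.

Lemma slim_anodes_near (i1 i2 i3 : 'I_n) (s1 s2 s3 : 'I_(M * n))
    (x := anode i1 s1 : G) (y := anode i2 s2 : G) (z := anode i3 s3 : G) :
  i1 != i2 -> i2 != i3 -> i3 != i1 ->
  avg (fun p : geodesic x y => avg (fun q : geodesic y z =>
      avg (fun r : geodesic z x => `|(slim p q r)%:R - M%:R|)))
  <= M%:R * (err x y + err y z + err z x).
Proof.
move=> n12 n23 n31; have M0 : 0 <= M%:R :> R by [].
(* Since [slim] is at most [M], the deviation is at most [M] and is nonzero only when
   [slim <= M.-1]; [b] will say that the long side is covered at radius [M.-1]. *)
have far (p : geodesic x y) (q : geodesic y z) (r : geodesic z x) (b : bool) :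
    ((slim p q r <= M.-1)%N -> b) ->
    `|(slim p q r)%:R - M%:R| <= M%:R * b%:R :> R.
  move=> sb; have sM : (slim p q r <= M)%N.
    by apply: slim_le; apply: covered_anodes.
  rewrite ler0_norm ?subr_le0 ?ler_nat // opprB.
  have [lt|ge] := leqP (slim p q r) M.-1.
    by rewrite sb // mulr1 lerBlDr lerDl.
  have -> : slim p q r = M by lia.
  by rewrite subrr mulr_ge0.
have := err_ge0 x y; have := err_ge0 y z; have := err_ge0 z x.
rewrite /err /= => e31 e23 e12.
(* Three cases according to the median junction; the long side is the one opposite to it, and its
   [gap] gives the exponent. *)
have [h3|h3] := boolP (minn i1 i2 <= i3 <= maxn i1 i2)%N.
  apply: (@le_trans _ _ (M%:R * 2^-1 ^+ gap i1 i2));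
    last by rewrite ler_wpM2l //; lra.
  apply: (@avg_unique3 _ (geodesic x y) (geodesic y z) (geodesic z x)
      (fun p q r => `|(slim p q r)%:R - M%:R|)
      (fun p q r => covered (side p) (side q :|: side r) M.-1)
      _ (gap i1 i2) (card_geodesic _ s1 s2 n12) M0).
  - move=> p q r; apply: far => le; have [c _ _] := covered_slim p q r.
    exact: coveredW le c.
  - by move=> p p' q r; apply: covered_long_side.
have [h1|h1] := boolP (minn i2 i3 <= i1 <= maxn i2 i3)%N.
  apply: (@le_trans _ _ (M%:R * 2^-1 ^+ gap i2 i3));
    last by rewrite ler_wpM2l //; lra.
  rewrite avg_exchange.
  apply: (@avg_unique3 _ (geodesic y z) (geodesic x y) (geodesic z x)
      (fun q p r => `|(slim p q r)%:R - M%:R|)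
      (fun q p r => covered (side q) (side r :|: side p) M.-1)
      _ (gap i2 i3) (card_geodesic _ s2 s3 n23) M0).
  - move=> q p r; apply: far => le; have [_ c _] := covered_slim p q r.
    exact: coveredW le c.
  - by move=> q q' p r; apply: covered_long_side.
have h2 : (minn i3 i1 <= i2 <= maxn i3 i1)%N by lia.
apply: (@le_trans _ _ (M%:R * 2^-1 ^+ gap i3 i1));
    last by rewrite ler_wpM2l //; lra.
(* Two exchanges bring the long side [r] outermost. *)
under eq_avg do rewrite avg_exchange.
rewrite avg_exchange.
apply: (@avg_unique3 _ (geodesic z x) (geodesic x y) (geodesic y z)
    (fun r p q => `|(slim p q r)%:R - M%:R|)
    (fun r p q => covered (side r) (side p :|: side q) M.-1)
    _ (gap i3 i1) (card_geodesic _ s3 s1 n31) M0).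
- move=> r p q; apply: far => le; have [_ _ c] := covered_slim p q r.
  exact: coveredW le c.
- by move=> r r' p q; apply: covered_long_side.
Qed.

Lemma slim_near (x y z : G) :
  `|avg (fun p : geodesic x y => avg (fun q : geodesic y z =>
      avg (fun r : geodesic z x => (slim p q r)%:R))) - M%:R|
  <= (12 * M)%:R * (err x y + err y z + err z x).
Proof.
have e0 := err_sum_ge0 x y z; apply: avg3_near.
have [e1|] := err_triangle x y z; last first.
  move=> [i1 [s1 [i2 [s2 [i3 [s3 [[ex ey ez] [n12 n23 n31]]]]]]]]; subst x y z.
  apply: le_trans (slim_anodes_near _ _ _ n12 n23 n31) _.
  by rewrite ler_wpM2r // ler_nat leq_pmull.
apply: avg_le_const => [|p]; first by rewrite mulr_ge0 ?ler0n.
apply: avg_le_const => [|q]; first by rewrite mulr_ge0 ?ler0n.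
apply: avg_le_const => [|r]; first by rewrite mulr_ge0 ?ler0n.
apply: le_trans (_ : (12 * M)%:R <= _); last by rewrite ler_peMr ?ler0n.
have sb : (slim p q r)%:R <= (12 * M)%:R :> R by rewrite ler_nat slim_bound.
have s0 : 0 <= (slim p q r)%:R :> R by [].
have MM : M%:R <= (12 * M)%:R :> R by rewrite ler_nat leq_pmull.
by rewrite ler_norml; apply/andP; split; lra.
Qed.

(** * Average of the error over two random vertices *)

Definition nonleaf (v : G) : R := (~~ leaf v)%:R.

Lemma card_H_graph : #|G| = (n + n * (M * n) + n.-1 * (2 * M) * 2)%N.
Proof. by rewrite !card_sum !card_prod !card_ord. Qed.

Lemma sum_H_graph (F : G -> R) :
  \sum_v F v = \sum_(i < n) F (cnode M i) +
    \sum_(i < n) \sum_(s < M * n) F (anode i s) +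
    \sum_(m < n.-1) \sum_(j < 2 * M) \sum_(k < 2) F (bnode m j k).
Proof.
rewrite /= !big_sumType /= !pair_bigA /=; congr (_ + _ + _).
  by apply: eq_bigr => -[].
by apply: eq_bigr => -[[]].
Qed.

(** There are at most [5 * M * n] vertices other than leaves, against [M * n ^ 2] leaves. *)
Lemma avg_nonleaf : (0 < n)%N -> avg nonleaf <= 5 / n%:R.
Proof.
move=> n0; rewrite /avg sum_H_graph.
rewrite ler_pdivrMr ?ltr0n ?card_H_graph; last by lia.
rewrite [X in _ + X + _]big1 => [|i _]; last exact: big1.
rewrite /nonleaf addr0 /= !sumr_const !card_ord.
rewrite -!mulrnA -mulrnDr !mul1n.
rewrite mulrAC ler_pdivlMr ?ltr0n //.
rewrite -!natrM ler_nat; nia.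
Qed.

Lemma sum_gap (i : 'I_n) : \sum_(j < n) 2^-1 ^+ gap i j <= 3 :> R.
Proof.
(* A discrete primitive of the two-sided geometric sequence, with values between 0 and 3; the sum
   telescopes. *)
pose U m : R := if (m <= i)%N then 2^-1 ^+ (i - m) else 3 - 2 * 2^-1 ^+ (m - i).
have US m : 2^-1 ^+ ((i - m) + (m - i))%N <= U m.+1 - U m.
  have [lt|gt|->] := ltngtP m i.
  - rewrite /U lt (ltnW lt) (_ : (m - i = 0)%N) ?addn0; last by lia.
    by rewrite (_ : (i - m = (i - m.+1).+1)%N) ?exprS; [lra|lia].
  - rewrite /U leqNgt ltnS (ltnW gt) /= leqNgt gt /=.
    rewrite (_ : (i - m = 0)%N) ?add0n; last by lia.
    by rewrite (_ : (m.+1 - i = (m - i).+1)%N) ?exprS; [lra|lia].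
  by rewrite /U ltnn leqnn subnn subSnn expr0 expr1; lra.
have -> : \sum_(j < n) 2^-1 ^+ gap i j =
    \sum_(0 <= j < n) 2^-1 ^+ ((i - j) + (j - i))%N :> R by rewrite big_mkord.
apply: le_trans (ler_sum _ (fun j _ => US j)) _.
rewrite telescope_sumr // /U leq0n; case: ifP => _.
  apply: le_trans (_ : 1 <= 3); last by lra.
  rewrite lerBlDr ler_wpDr ?exprn_ge0 ?invr_ge0 //.
  by rewrite exprn_ile1 ?invr_ge0 // invf_le1 //; lra.
have e1 : 0 <= 2^-1 ^+ (n - i) :> R by rewrite exprn_ge0 ?invr_ge0.
have e2 : 0 <= 2^-1 ^+ (i - 0) :> R by rewrite exprn_ge0 ?invr_ge0.
lra.
Qed.

(** The part of [err] carried by pairs of leaves; the rest is bounded by [nonleaf u + nonleaf v]. *)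
Definition leaf_err (u v : G) : R :=
  match u, v with
  | inl (inr (i, _)), inl (inr (j, _)) => 2^-1 ^+ gap i j
  | _, _ => 0
  end.

(** Each junction carries [M * n] leaves, so the sum over [v] is at most [3 * M * n], while the
    graph has at least [M * n ^ 2] vertices. *)
Lemma avg_leaf_err u : (0 < n)%N -> avg (leaf_err u) <= 3 / n%:R.
Proof.
move=> n0; rewrite /avg ler_pdivrMr ?ltr0n ?card_H_graph; last by lia.
apply: (@le_trans _ _ (3 * (M * n)%:R)); last first.
  rewrite mulrAC ler_pdivlMr ?ltr0n // -!natrM ler_nat; lia.
rewrite sum_H_graph.
rewrite [X in X + _ + _]big1 => [|i _]; last by case: u => [[|[]]|[[]]].
rewrite [X in _ + X]big1 => [|m _]; last first.
  by apply: big1 => j _; apply: big1 => k _; case: u => [[|[]]|[[]]].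
rewrite add0r addr0; have c0 : 0 <= 3 * (M * n)%:R :> R by rewrite mulr_ge0.
case: u => [[i|[i s]]|[[m j] k]] /=; try by rewrite big1 // => *; apply: big1.
under eq_bigr do rewrite sumr_const card_ord.
by rewrite sumrMnl -[X in X <= _]mulr_natr ler_wpM2r // sum_gap.
Qed.

(** The constant is 5 + 5 + 3: one [nonleaf] term for each vertex and one [leaf_err] term. *)
Lemma avg_err : (0 < n)%N -> avg (fun u => avg (err u)) <= 13 / n%:R.
Proof.
move=> n0; have G0 : (0 < #|G|)%N by rewrite card_H_graph; lia.
have le u v : err u v <= nonleaf u + nonleaf v + leaf_err u v.
  by case: u v => [[i|[i s]]|[[m j] k]] [[i'|[i' s']]|[[m' j'] k']];
    rewrite /nonleaf /=; lra.
have {le} le u : avg (err u) <= nonleaf u + avg nonleaf + 3 / n%:R.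
  apply: le_trans (avg_le (le u)) _; rewrite !avgD avg_const // lerD2l.
  exact: avg_leaf_err.
apply: le_trans (avg_le le) _; rewrite !avgD !avg_const //.
have := avg_nonleaf n0; set a := avg nonleaf; move: (n%:R^-1) => b; lra.
Qed.

(** The constant 468 is 12 * 3 * 13: deviation factor, number of pairs of corners, average error of
    a pair. *)
Lemma E_near (f : forall x y z : G,
    geodesic x y -> geodesic y z -> geodesic z x -> nat) (l : R) : (0 < n)%N ->
  (forall x y z, `|avg (fun p : geodesic x y => avg (fun q : geodesic y z =>
      avg (fun r : geodesic z x => (f x y z p q r)%:R))) - l|
    <= (12 * M)%:R * (err x y + err y z + err z x)) ->
  `|E_triangle R f - l| <= (468 * M)%:R / n%:R.
Proof.
move=> n0 near; have G0 : (0 < #|G|)%N by rewrite card_H_graph; lia.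
apply: le_trans (E_triangle_near G0 near) _.
have -> : (468 * M)%:R / n%:R = (12 * M)%:R * (3 * (13 / n%:R)) :> R.
  by rewrite !natrM; ring.
by rewrite !ler_wpM2l // avg_err.
Qed.

End Limit.

Local Open Scope classical_set_scope.
Local Open Scope ring_scope.

Lemma cvg_rate (R : realType) (u : nat -> R) (l : R) (c : nat) :
  (forall n, (0 < n)%N -> `|u n - l| <= c%:R / n%:R) ->
  u @ \oo --> l.
Proof.
move=> rate; apply/cvgrPdist_le => e e0.
have ce0 : 0 <= c%:R / e by rewrite divr_ge0 // ltW.
(* Beyond the Archimedean bound of [c / e] the rate [c / n] is below [e]; the successor makes [n]
   positive. *)
exists (Num.bound (c%:R / e)).+1 => // n /= bn; rewrite distrC.
have n0 : (0 < n)%N by apply: leq_trans bn.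
apply: le_trans (rate n n0) _.
rewrite ler_pdivrMr ?ltr0n // mulrC -ler_pdivrMr //.
apply: le_trans (ltW (archi_boundP ce0)) _.
by rewrite ler_nat ltnW.
Qed.

Theorem theorem4p2 (R : realType) (M : nat) (M_gt0 : (0 < M)%N) :
  ((fun n : nat => E_slim R (H_graph M n M_gt0)) @ \oo --> (M%:R : R)) /\
  ((fun n : nat => E_minsize R (H_graph M n M_gt0)) @ \oo --> (0 : R)).
Proof.
split; apply: (@cvg_rate _ _ _ (468 * M)) => n n0; apply: E_near => // x y z.
- exact: slim_near.
- exact: minsize_near.
Qed.
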